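(* Let $H$ be a Hilbert space, let $A\subseteq B(H)$ be a commutative von Neumann algebra, and suppose there exists a faithful conditional expectation $E:B(H)\to A$. Then $A$ is atomic.
   Context: A von Neumann algebra $A\subseteq B(H)$ contains the identity of $B(H)$. A conditional expectation $E:B(H)\to A$ is a positive contractive linear map with $E(a)=a$ for $a\in A$ and $E(axb)=aE(x)b$ for $a,b\in A$, $x\in B(H)$; no normality is assumed. It is faithful if $x\ge 0$ and $E(x)=0$ imply $x=0$. A commutative von Neumann algebra is atomic if every nonzero projection in it dominates a minimal nonzero projection. The Hilbert space $H$ need not be separable. *)

(* Defs.v *)
From HB Require Import structures.
From mathcomp Require Import all_boot all_order all_algebra.
From mathcomp Require Import sesquilinear complex.
From mathcomp Require Import mathcomp_extra boolp classical_sets functions.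
From mathcomp Require Import reals topology normedtype.

Set Implicit Arguments.
Unset Strict Implicit.
Unset Printing Implicit Defensive.

Import Order.TTheory GRing.Theory Num.Theory.
Import numFieldNormedType.Exports.

Local Open Scope classical_set_scope.
Local Open Scope complex_scope.
Local Open Scope ring_scope.

(* [hdot] is linear in its first argument and conjugate-linear in its second
   one. No separability is assumed, and the zero space is allowed. *)
HB.mixin Record NormedModule_isPreHilbert (R : realType) H
    of NormedModule R[i] H := {
  hdot : {dot H for @Num.conj R[i]};
  normrX2_hdot : forall u : H, `|u| ^+ 2 = hdot u u
}.

#[short(type="hilbertType")]
HB.structure Definition Hilbert (R : realType) :=
  {H of CompleteNormedModule R[i] H & NormedModule_isPreHilbert R H}.

Section BoundedOperators.
Variables (R : realType) (H : hilbertType R).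
Implicit Types (f : H -> H) (M : R).

(* The norm of [H] is [R[i]]-valued (with nonnegative real values). *)
Definition op_bound f : set R :=
  [set M | 0 <= M /\ forall u : H, `|f u| <= M%:C * `|u|].

Definition bounded_linear : {pred H -> H} :=
  fun f => `[< linear f /\ op_bound f !=set0 >].

Record bop := Bop { bop_fun :> H -> H; _ : bop_fun \in bounded_linear }.

HB.instance Definition _ := [isSub for bop_fun].
HB.instance Definition _ := [Choice of bop by <:].

Lemma bounded_linearP f :
  reflect (linear f /\ op_bound f !=set0) (f \in bounded_linear).
Proof. exact: asboolP. Qed.

Fact bounded_linear_submod_closed : submod_closed bounded_linear.
Proof.
split=> [|a f g /bounded_linearP[lf [M [M0 hM]]]
          /bounded_linearP[lg [N [N0 hN]]]]; apply/bounded_linearP; split.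
- by move=> a u v; rewrite -[LHS]/0 -[RHS]/(a *: 0 + 0) scaler0 addr0.
- by exists 0; split=> // u; rewrite -[0 u]/0 normr0 rmorph0 mul0r.
- move=> b u v; change (a *: f (b *: u + v) + g (b *: u + v)
    = b *: (a *: f u + g u) + (a *: f v + g v)).
  rewrite lf lg !scalerDr !scalerA (mulrC a b).
  by rewrite addrACA.
- have [K aK] : exists K : R, K%:C = `|a|.
    by case: a => x y; rewrite normc_def; eexists.
  have K0 : 0 <= K by rewrite -lecR aK normr_ge0.
  exists (K * M + N); split=> [|u]; first by rewrite addr_ge0// mulr_ge0.
  apply: (le_trans (ler_normD (a *: f u) (g u))).
  rewrite normrZ rmorphD rmorphM /= aK mulrDl.
  by rewrite lerD// -mulrA ler_wpM2l.
Qed.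

HB.instance Definition _ := GRing.isSubmodClosed.Build R[i] (H -> H)
  bounded_linear bounded_linear_submod_closed.
HB.instance Definition _ := [SubChoice_isSubLmodule of bop by <:].

Fact bop_linear (x : bop) : linear x.
Proof. by case: x => f /= /bounded_linearP[]. Qed.

HB.instance Definition _ (x : bop) :=
  GRing.isLinear.Build R[i] H H _ x (bop_linear x).

Fact bop_op_bound (x : bop) : op_bound x !=set0.
Proof. by case: x => f /= /bounded_linearP[]. Qed.

Fact bop_one_subproof : @idfun H \in bounded_linear.
Proof.
apply/bounded_linearP; split=> //.
by exists 1; split=> // u; rewrite rmorph1 mul1r.
Qed.

Fact bop_mul_subproof (x y : bop) : x \o y \in bounded_linear.
Proof.
apply/bounded_linearP; split=> [a u v /=|]; first by rewrite !linearP.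
have [M [M0 hM]] := bop_op_bound x; have [N [N0 hN]] := bop_op_bound y.
exists (M * N); split=> [|u /=]; first exact: mulr_ge0.
by rewrite (le_trans (hM _))// rmorphM -mulrA ler_wpM2l ?lecR.
Qed.

Definition bop_one := Bop bop_one_subproof.
Definition bop_mul x y := Bop (bop_mul_subproof x y).

Fact bop_mulA : associative bop_mul.
Proof. by move=> x y z; apply: val_inj. Qed.
Fact bop_mul1r : left_id bop_one bop_mul.
Proof. by move=> x; apply: val_inj. Qed.
Fact bop_mulr1 : right_id bop_one bop_mul.
Proof. by move=> x; apply: val_inj. Qed.
Fact bop_mulDl : left_distributive bop_mul +%R.
Proof. by move=> x y z; apply: val_inj. Qed.
Fact bop_mulDr : right_distributive bop_mul +%R.
Proof. by move=> x y z; apply: val_inj; apply/funext => u; exact: raddfD. Qed.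

(* Only a possibly trivial ring, as [H] may be the zero space. *)
HB.instance Definition _ := GRing.Zmodule_isPzRing.Build bop
  bop_mulA bop_mul1r bop_mulr1 bop_mulDl bop_mulDr.

End BoundedOperators.

Notation "''B(' H )" := (bop H) (format "''B(' H )") : type_scope.

Section Operators.
Variables (R : realType) (H : hilbertType R).
Implicit Types (x y p : 'B(H)).

Definition opnorm x : R := inf (op_bound x).

Definition is_adjoint x y := forall u v : H, hdot (x u) v = hdot u (y v).

(* In [R[i]], [0 <= z] means that [z] is real and nonnegative. *)
Definition op_positive x := forall u : H, 0 <= hdot (x u) u.

Definition op_le x y := op_positive (y - x).

Definition projection p := is_adjoint p p /\ p * p = p.

Definition matrix_coef x (uv : H * H) : R[i]^o := hdot (x uv.1) uv.2.

(* The weak operator topology: the coarsest one for which all the maps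
   [fun x => hdot (x u) v] are continuous. *)
Definition wot :=
  initial_topology (matrix_coef : 'B(H) -> {ptws (H * H) -> R[i]^o}).

End Operators.

Section VonNeumannAlgebras.
Variables (R : realType) (H : hilbertType R).
Implicit Types (A : set 'B(H)) (E : 'B(H) -> 'B(H)).

Record von_neumann_algebra A : Prop := {
  vna_linear : forall (c : R[i]) a b, A a -> A b -> A (c *: a + b);
  vna_one : A 1;
  vna_mul : forall a b, A a -> A b -> A (a * b);
  vna_adjoint : forall a, A a -> exists2 b, A b & is_adjoint a b;
  vna_closed : closed (A : set (wot H))
}.

Definition commutative_algebra A := forall a b, A a -> A b -> a * b = b * a.

(* Maps [B(H) -> A] are represented as maps [B(H) -> B(H)] with values in [A].
   Normality (weak-* continuity) is not required. *)
Record conditional_expectation A (E : {linear 'B(H) -> 'B(H)}) : Prop := {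
  ce_codom : forall x, A (E x);
  ce_positive : forall x, op_positive x -> op_positive (E x);
  ce_contractive : forall x, opnorm (E x) <= opnorm x;
  ce_id : forall a, A a -> E a = a;
  ce_bimodule : forall a b x, A a -> A b -> E (a * x * b) = a * E x * b
}.

Definition faithful E := forall x, op_positive x -> E x = 0 -> x = 0.

Definition minimal_projection A q :=
  [/\ A q, projection q, q <> 0 &
      forall r, A r -> projection r -> op_le r q -> r = 0 \/ r = q].

Definition atomic A :=
  forall p, A p -> projection p -> p <> 0 ->
    exists2 q, minimal_projection A q & op_le q p.

End VonNeumannAlgebras.

(* Main.v *)
(**
Let [p] be a nonzero projection of [A], [xi] a nonzero vector of its range and
[a] the image under [E] of the rank one operator [x = (. , xi) xi]. By
faithfulness [a <> 0], so the inequality [e a <= c e] fails at [e = p] for some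
[c > 0]. It holds however at every projection [e] of [A] with
[|e xi|^2 <= c], because [e x e] is the rank one operator of [e xi] and hence
at most [c 1], and it passes from two projections to their sum. Call a
projection of [A] below [p] bad if the inequality fails. The infimum [q] of a
chain of bad projections is its strong limit: some [e] of the chain has
[|(e - q) xi|^2 <= c], so [q] is bad as well. By Zorn's lemma there is a minimal
bad projection [e], and it is a minimal projection: if [r <= e], then [r] or
[e - r] is bad, that is, equal to [e].
*)
Require Import Defs.
From HB Require Import structures.
From mathcomp Require Import all_boot all_order all_algebra complex.
From mathcomp Require Import sesquilinear boolp.
From mathcomp Require Import classical_sets.
From mathcomp Require Import reals topology normedtype.
From mathcomp Require Import ring.

Set Implicit Arguments.
Unset Strict Implicit.
Unset Printing Implicit Defensive.

Import Order.TTheory GRing.Theory Num.Theory.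
Import numFieldNormedType.Exports.

Local Open Scope classical_set_scope.
Local Open Scope complex_scope.
Local Open Scope ring_scope.

Section HilbertSpace.
Variables (R : realType) (H : hilbertType R).
Implicit Types (x y a e f p q : 'B(H)) (u v w xi : H).

(** * Inner product and Cauchy-Schwarz inequality *)

Lemma hdotDl u v w : hdot (u + v) w = hdot u w + hdot v w.
Proof. by rewrite linearDl. Qed.

Lemma hdotDr u v w : hdot w (u + v) = hdot w u + hdot w v.
Proof. by rewrite linearDr. Qed.

Lemma hdotBl u v w : hdot (u - v) w = hdot u w - hdot v w.
Proof. by rewrite linearBl. Qed.

Lemma hdotBr u v w : hdot w (u - v) = hdot w u - hdot w v.
Proof. by rewrite linearBr. Qed.

Lemma hdotZl c u v : hdot (c *: u) v = c * hdot u v.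
Proof. by rewrite linearZl_LR. Qed.

Lemma hdotZr c u v : hdot u (c *: v) = Num.conj c * hdot u v.
Proof. by rewrite linearZr_LR. Qed.

Lemma hdotC u v : Num.conj (hdot u v) = hdot v u.
Proof. by rewrite [RHS]hermC mul1r. Qed.

Lemma hdot_ge0 u : 0 <= hdot u u.
Proof. by rewrite -normrX2_hdot exprn_ge0. Qed.

Lemma hdot_eq0 u : hdot u u = 0 -> u = 0.
Proof.
by rewrite -normrX2_hdot => /eqP; rewrite expf_eq0/= normr_eq0 => /eqP.
Qed.

Lemma hdot_inj u w : (forall v, hdot u v = hdot w v) -> u = w.
Proof.
move=> uw; apply/eqP; rewrite -subr_eq0; apply/eqP; apply: hdot_eq0.
by rewrite hdotBl uw subrr.
Qed.

(** The square of the norm of [hdot v v *: u - hdot u v *: v] is nonnegative and equals [hdot v v]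
    times the difference of the squared sides. *)
Lemma hdot_CauchySchwarz u v : `|hdot u v| <= `|u| * `|v|.
Proof.
have [->|v0] := eqVneq v 0.
  by rewrite linear0r !normr0 mulr0.
have vgt0 : 0 < hdot v v by rewrite -normrX2_hdot exprn_gt0// normr_gt0.
rewrite -(@ler_pXn2r _ 2)// ?nnegrE ?mulr_ge0// exprMn !normrX2_hdot.
have := hdot_ge0 (hdot v v *: u - hdot u v *: v).
rewrite !(hdotBl, hdotBr, hdotZl, hdotZr) normCK !hdotC => h.
rewrite -subr_ge0 -(pmulr_rge0 _ vgt0).
by apply: le_trans h _; rewrite le_eqVlt; apply/orP; left; apply/eqP; ring.
Qed.

(** * Operators and their quadratic forms *)

Lemma bop_ext x y : x =1 y -> x = y.
Proof. by move=> xy; apply: val_inj; apply/funext. Qed.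

Lemma bop_mulE x y u : (x * y) u = x (y u). Proof. by []. Qed.
Lemma bop_addE x y u : (x + y) u = x u + y u. Proof. by []. Qed.
Lemma bop_subE x y u : (x - y) u = x u - y u. Proof. by []. Qed.
Lemma bop_scaleE c x u : (c *: x) u = c *: x u. Proof. by []. Qed.

Lemma bopD x u v : x (u + v) = x u + x v. Proof. exact: linearD. Qed.
Lemma bopB x u v : x (u - v) = x u - x v. Proof. exact: linearB. Qed.
Lemma bopZ x c u : x (c *: u) = c *: x u. Proof. exact: linearZ. Qed.

Lemma quadratic_form_eq0 a : (forall u, hdot (a u) u = 0) -> a = 0.
Proof.
move=> a0; apply: bop_ext => u; apply: hdot_eq0.
have pol v w : hdot (a v) w + hdot (a w) v = 0.
  have := a0 (v + w).
  by rewrite bopD hdotDl !hdotDr !a0 add0r addr0.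
(* Polarization at [a u] and at ['i *: a u] gives both the sum and the difference of
   [hdot (a u) (a u)] and [hdot (a (a u)) u] as zero. *)
have h1 := pol u (a u).
have := pol u ('i%R *: a u).
rewrite bopZ hdotZl hdotZr /= conjCi.
rewrite mulNr addrC -mulrBr => /eqP.
rewrite mulf_eq0 (negbTE (neq0Ci _)) /= subr_eq0 => /eqP h2.
by move: h1; rewrite h2 => /eqP; rewrite -mulr2n mulrn_eq0 /= => /eqP.
Qed.

(** * Rank one operators *)

Lemma rank1_subproof xi : (fun u => hdot u xi *: xi) \in @bounded_linear R H.
Proof.
apply/bounded_linearP; split=> [c u v|].
  by rewrite /= hdotDl hdotZl scalerDl scalerA.
have [K xiK] : exists K : R, K%:C = `|xi| ^+ 2.
  by exists (complex.Re (`|xi| ^+ 2)); rewrite RRe_real// ger0_real// exprn_ge0.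
exists K; split=> [|u].
  by rewrite -lecR xiK exprn_ge0.
by rewrite normrZ xiK expr2 mulrAC ler_wpM2r// mulrC hdot_CauchySchwarz.
Qed.

Definition rank1 xi : 'B(H) := Bop (rank1_subproof xi).

Lemma rank1E xi u : rank1 xi u = hdot u xi *: xi. Proof. by []. Qed.

Lemma hdot_rank1 xi u : hdot (rank1 xi u) u = `|hdot u xi| ^+ 2.
Proof. by rewrite rank1E hdotZl normCK hdotC. Qed.

Lemma rank1_positive xi : op_positive (rank1 xi).
Proof. by move=> u; rewrite hdot_rank1 exprn_ge0. Qed.

Lemma rank1_le xi c : `|xi| ^+ 2 <= c -> op_le (rank1 xi) (c *: (1 : 'B(H))).
Proof.
move=> xic u; rewrite bop_subE hdotBl hdot_rank1 subr_ge0 hdotZl.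
rewrite -[hdot _ u]normrX2_hdot.
rewrite (@le_trans _ _ ((`|u| * `|xi|) ^+ 2))//.
  by rewrite ler_pXn2r ?nnegrE ?mulr_ge0 ?hdot_CauchySchwarz.
by rewrite exprMn mulrC ler_wpM2r ?exprn_ge0.
Qed.

Lemma rank1_eq0 xi : rank1 xi = 0 -> xi = 0.
Proof.
move=> /(congr1 (fun x : 'B(H) => x xi)); rewrite rank1E => /eqP.
by rewrite scaler_eq0 orbC => /orP[/eqP//|/eqP/hdot_eq0].
Qed.

Lemma rank1_conj xi e : is_adjoint e e -> e * rank1 xi * e = rank1 (e xi).
Proof.
move=> ee; apply: bop_ext => u.
by rewrite !bop_mulE !rank1E bopZ ee.
Qed.

(** * Projections and their order *)

Lemma projection_norm e u : projection e -> hdot (e u) u = `|e u| ^+ 2.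
Proof. by case=> ee e2; rewrite normrX2_hdot -{1}e2 bop_mulE ee. Qed.

Lemma projection_positive e : projection e -> op_positive e.
Proof. by move=> pe u; rewrite projection_norm// exprn_ge0. Qed.

Lemma projectionB e f : projection e -> projection f ->
  e * f = f -> f * e = f -> projection (e - f).
Proof.
move=> [ee e2] [ff f2] ef fe; split=> [u v|].
  by rewrite !bop_subE hdotBl hdotBr ee ff.
by rewrite mulrBl !mulrBr e2 f2 ef fe subrr subr0.
Qed.

(** The algebraic form of the order: chain arguments become computations with products. On
    projections it agrees with [op_le]. *)
Definition proj_le f e := f * e = f /\ e * f = f.

Lemma proj_le_trans e f g : proj_le e f -> proj_le f g -> proj_le e g.
Proof.
move=> [ef fe] [fg gf]; split; first by rewrite -ef -mulrA fg.
by rewrite -fe mulrA gf.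
Qed.

Lemma mul_proj_le e f : projection e -> projection f -> e * f = f ->
  proj_le f e.
Proof.
move=> [ee _] [ff _] ef; split=> //; apply: bop_ext => u; apply: hdot_inj => v.
by rewrite bop_mulE ff ee -bop_mulE ef -ff.
Qed.

(** For [w] in the range of [1 - e], the inequality gives [|f w|^2 <= |e w|^2 = 0], so
    [f * (1 - e) = 0]; the other product follows by taking adjoints. *)
Lemma op_le_proj_le e f : projection e -> projection f ->
  op_le f e -> proj_le f e.
Proof.
move=> pe pf fe; have feE : f * e = f.
  apply/esym/eqP; rewrite -subr_eq0; apply/eqP; apply: bop_ext => u.
  rewrite -{1}[f]mulr1 -mulrBr bop_mulE.
  have := fe ((1 - e) u).
  rewrite bop_subE hdotBl !projection_norm// -bop_mulE mulrBr mulr1 (proj2 pe).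
  rewrite subrr normr0 expr0n sub0r oppr_ge0 => h.
  have : `|f ((1 - e) u)| ^+ 2 == 0 by rewrite eq_le h exprn_ge0.
  by rewrite expf_eq0 /= normr_eq0 => /eqP.
split=> //; case: pe pf => [ee _] [ff _]; apply: bop_ext => u.
by apply: hdot_inj => v; rewrite bop_mulE ee ff -bop_mulE feE -ff.
Qed.

Lemma proj_le_op_le e f : projection e -> projection f ->
  proj_le f e -> op_le f e.
Proof. by move=> pe pf [fe ef]; apply/projection_positive/projectionB. Qed.

Lemma normr_projectionB e f u : projection e -> projection f ->
  proj_le f e -> `|(e - f) u| ^+ 2 = `|e u| ^+ 2 - `|f u| ^+ 2.
Proof.
move=> pe pf [fe ef]; rewrite -!projection_norm//; last exact: projectionB.
by rewrite bop_subE hdotBl.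
Qed.

Lemma complex_gt0P (z : R[i]) : 0 < z -> exists2 r : R, 0 < r & r%:C = z.
Proof.
move=> z0; have zE : (complex.Re z)%:C = z by rewrite RRe_real// gtr0_real.
by exists (complex.Re z) => //; rewrite -ltcR zE.
Qed.

Lemma projection_contractive e u : projection e -> `|e u| <= `|u|.
Proof.
move=> pe; have [->|eu0] := eqVneq (e u) 0; first by rewrite normr0.
have eu_gt0 : 0 < `|e u| by rewrite normr_gt0.
rewrite -(ler_pM2l eu_gt0) -expr2 -projection_norm//.
rewrite (le_trans (real_ler_norm _)) ?hdot_CauchySchwarz//.
by rewrite projection_norm// ger0_real// exprn_ge0.
Qed.

(** * Strong limits of operators and of chains of projections *)

Lemma cvg_hdotl T (F : set_system T) (FF : Filter F) (g : T -> H) u v :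
  g @ F --> u -> (fun t => hdot (g t) v : R[i]^o) @ F --> (hdot u v : R[i]^o).
Proof.
move=> gu; apply/cvgrPdist_lt => eps eps0.
have v1 : 0 < `|v| + 1 by rewrite ltr_wpDl.
have : \forall t \near F, `|u - g t| < eps / (`|v| + 1).
  by move/cvgrPdist_lt : gu; apply; rewrite divr_gt0.
apply: filterS => t; rewrite ltr_pdivlMr// => h.
rewrite -hdotBl (le_lt_trans (hdot_CauchySchwarz _ _))//.
by rewrite (le_lt_trans _ h)// ler_wpM2l// lerDl.
Qed.

Lemma cvg_hdotr T (F : set_system T) (FF : Filter F) (g : T -> H) u v :
  g @ F --> u -> (fun t => hdot v (g t) : R[i]^o) @ F --> (hdot v u : R[i]^o).
Proof.
move=> gu; apply/cvgrPdist_lt => eps eps0.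
have v1 : 0 < `|v| + 1 by rewrite ltr_wpDl.
have : \forall t \near F, `|u - g t| < eps / (`|v| + 1).
  by move/cvgrPdist_lt : gu; apply; rewrite divr_gt0.
apply: filterS => t; rewrite ltr_pdivlMr// => h.
rewrite -hdotBr (le_lt_trans (hdot_CauchySchwarz _ _))//.
by rewrite mulrC (le_lt_trans _ h)// ler_wpM2l// lerDl.
Qed.

(** Strong convergence implies weak convergence, since each matrix coefficient is continuous in the
    value of the operator. This brings strong limits under [vna_closed]. *)
Lemma cvg_wot (F : set_system 'B(H)) (FF : Filter F) (q : 'B(H)) :
  (forall u, (fun e : 'B(H) => e u) @ F --> q u) -> F --> (q : wot H).
Proof.
move=> Fq.
have Fpt : {ptws, (@matrix_coef R H : 'B(H) -> {ptws (H * H) -> R[i]^o}) @ F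
                    --> matrix_coef q}.
  by apply/pointwise_cvgP => -[u v]; exact: cvg_hdotl.
move=> B /= [_ [[O Oop <-] Oq] OB].
apply: filterS OB _.
by apply: Fpt; exact: open_nbhs_nbhs.
Qed.

(** The infimum is the strong limit along the filter [F] generated by the lower sections of the
    chain. *)
Lemma projection_chain_inf (C : set 'B(H)) :
  C !=set0 -> C `<=` @projection R H ->
  (forall e f, C e -> C f -> proj_le e f \/ proj_le f e) ->
  exists q, [/\ projection q, forall e, C e -> proj_le q e,
    forall u eps, 0 < eps -> exists2 e, C e & `|e u - q u| < eps &
    forall A : set 'B(H), closed (A : set (wot H)) -> C `<=` A -> A q].
Proof.
move=> [e0 Ce0] Cp Ctot.
pose F := filter_from C (fun f => [set e | C e /\ proj_le e f]).
have le_refl e : C e -> proj_le e e by move=> /Cp[_ ee]; split.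
have FF : ProperFilter F.
  apply: filter_from_proper; last first.
    by move=> f Cf; exists f; split => //; exact: le_refl.
  apply: filter_from_filter; first by exists e0.
  move=> e f Ce Cf; have [ef|fe] := Ctot _ _ Ce Cf.
    by exists e => // g [Cg ge]; split; split => //; exact: proj_le_trans ef.
  by exists f => // g [Cg ge]; split; split => //; exact: proj_le_trans fe.
have Fdown f : C f -> \forall e \near F, C e /\ proj_le e f.
  by move=> Cf; exists f.
have FC : \forall e \near F, C e by apply: filterS (Fdown _ Ce0) => e [].
have Fcvg u : cvg ((fun e : 'B(H) => e u) @ F).
  apply: cauchy_cvg; apply: cauchy_exP => _ /complex_gt0P[eps eps0 <-].
  (* The squared norms are taken in [R], where infima exist. *)
  pose nu (e : 'B(H)) : R := complex.Re (`|e u| ^+ 2).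
  have nuE e : (nu e)%:C = `|e u| ^+ 2.
    by rewrite /nu RRe_real// ger0_real// exprn_ge0.
  have hinf : has_inf (nu @` C).
    split; first by exists (nu e0), e0.
    by exists 0 => _ [e _ <-]; rewrite -lecR nuE exprn_ge0.
  (* Here [|f u|^2] is within [eps^2] of the infimum, so by Pythagoras every [e] of the chain below
     [f] satisfies [|f u - e u| < eps]. *)
  have [_ [f Cf <-] fl] := @inf_adherent _ (nu @` C) _ (exprn_gt0 2 eps0) hinf.
  exists (f u); rewrite /fmap /=.
  apply: filterS (Fdown _ Cf) => e [Ce ef].
  rewrite /= -ball_normE /ball_ /=.
  rewrite -bop_subE -(@ltr_pXn2r _ 2)// ?nnegrE ?normr_ge0 ?lecR ?(ltW eps0)//.
  rewrite normr_projectionB//; [|exact: Cp|exact: Cp].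
  rewrite -!nuE -rmorphB -rmorphXn ltcR.
  rewrite ltrBlDr addrC; apply: (lt_le_trans fl); rewrite lerD2r.
  by apply: ge_inf; [case: hinf|exists e].
pose q0 u : H := lim ((fun e : 'B(H) => e u) @ F).
have Fq u : (fun e : 'B(H) => e u) @ F --> q0 u by exact: Fcvg.
have q0_linear : linear q0.
  move=> c u v.
  apply: (@norm_cvg_unique _ _ ((fun e : 'B(H) => e (c *: u + v)) @ F)).
    exact: Fq.
  have -> : (fun e : 'B(H) => e (c *: u + v)) =
      (fun e : 'B(H) => c *: e u + e v).
    by apply/funext => e; exact: linearP.
  apply: cvgD; last exact: Fq.
  by apply: cvgZr; exact: Fq.
have q0_bounded u : `|q0 u| <= `|u|.
  apply/ler_addgt0Pr => eps eps0.
  have [e [Ce qe]] : exists e, C e /\ `|q0 u - e u| < eps.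
    apply: (@filter_ex _ F); apply: filterI => //.
    by move/cvgrPdist_lt: (Fq u); apply.
  rewrite -(subrK (e u) (q0 u)) addrC (le_trans (ler_normD _ _))//.
  by rewrite lerD ?projection_contractive ?ltW//; exact: Cp.
have q0P : q0 \in @bounded_linear R H.
  by apply/bounded_linearP; split=> //; exists 1; split=> // u; rewrite mul1r.
have q0_id e u : C e -> e (q0 u) = q0 u.
  move=> Ce; apply/eqP; rewrite -subr_eq0 -normr_le0.
  apply/ler_addgt0Pr => eps eps0; rewrite add0r.
  have eps2 : 0 < eps / 2 by rewrite divr_gt0.
  (* Since [e] fixes the range of each [f] below it, [e (q0 u) - q0 u] only depends on the small
     vector [q0 u - f u]. *)
  have [f [[Cf [fe ef]] qf]] :
      exists f, (C f /\ proj_le f e) /\ `|q0 u - f u| < eps / 2.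
    apply: (@filter_ex _ F); apply: filterI; first exact: Fdown.
    by move/cvgrPdist_lt: (Fq u); apply.
  have -> : e (q0 u) - q0 u = e (q0 u - f u) - (q0 u - f u).
    by rewrite bopB -bop_mulE ef opprB addrA subrK.
  rewrite (le_trans (ler_normB _ _))// [leRHS]splitr lerD// ?ltW//.
  by rewrite (le_lt_trans (projection_contractive _ _))//; exact: Cp.
pose q : 'B(H) := Bop q0P.
have pq : projection q.
  split=> [u v|].
    apply: (@norm_cvg_unique _ R[i]^o
      ((fun e : 'B(H) => hdot (e u) v : R[i]^o) @ F)).
      exact: cvg_hdotl.
    have : (fun e : 'B(H) => hdot u (e v) : R[i]^o) @ F -->
        (hdot u (q v) : R[i]^o).
      exact: cvg_hdotr.
    apply: cvg_trans; apply: near_eq_cvg.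
    by apply: filterS FC => e /Cp[ee _]; rewrite ee.
  apply: bop_ext => u; rewrite bop_mulE.
  apply: (@norm_cvg_unique _ _ ((fun e : 'B(H) => e (q u)) @ F)).
    exact: Fq.
  (* Along [F] the vectors [e (q u)] are constantly [q u], and they also converge to [q (q u)]. *)
  have : (fun _ : 'B(H) => q u) @ F --> q u by exact: cvg_cst.
  apply: cvg_trans; apply: near_eq_cvg.
  by apply: filterS FC => e Ce; rewrite /= q0_id.
exists q; split => //.
- move=> e Ce; apply: mul_proj_le => //; first exact: Cp.
  by apply: bop_ext => u; rewrite bop_mulE /= q0_id.
- move=> u eps eps0.
  have [e [Ce qe]] : exists e, C e /\ `|q u - e u| < eps.
    apply: (@filter_ex _ F); apply: filterI => //.
    by move/cvgrPdist_lt: (Fq u); apply.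
  by exists e; rewrite // distrC.
- move=> A Acl CA.
  apply: (@closed_cvg _ (wot H) F _ idfun A Acl _ q); last exact: cvg_wot.
  exact: filterS FC.
Qed.

End HilbertSpace.

(** * Minimal projections from a faithful expectation *)

Section FaithfulExpectation.
Variables (R : realType) (H : hilbertType R).
Implicit Types (e p : 'B(H)) (xi : H).
Variables (A : set 'B(H)) (E : {linear 'B(H) -> 'B(H)}).
Hypotheses (Avn : von_neumann_algebra A) (Acomm : commutative_algebra A).
Hypotheses (EA : conditional_expectation A E) (Efaithful : faithful E).

Lemma vnaB a b : A a -> A b -> A (a - b).
Proof.
by move=> Aa Ab; rewrite addrC -scaleN1r; exact: (vna_linear Avn).
Qed.

(** Applying [E] to [rank1 (e xi) <= c 1] gives [e * E (rank1 xi) <= c 1] by the bimodule property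
    and commutativity; compressing by [e] turns [c 1] into [c e]. *)
Lemma expectation_rank1_le e xi c : A e -> projection e ->
  `|e xi| ^+ 2 <= c -> op_le (e * E (rank1 xi)) (c *: e).
Proof.
move=> Ae [ee e2] /rank1_le; rewrite -rank1_conj// => /(ce_positive EA).
rewrite linearB linearZ /= (ce_id EA (vna_one Avn)) (ce_bimodule EA)//.
have -> : e * E (rank1 xi) * e = e * E (rank1 xi).
  by rewrite (Acomm (vna_mul Avn Ae (ce_codom EA _)) Ae) mulrA e2.
move=> h u; have := h (e u).
rewrite !bop_subE !bop_scaleE -ee !bopB !bopZ -!bop_mulE.
by rewrite mulr1 e2 mulrA e2 -mulrA (Acomm (ce_codom EA _) Ae) mulrA e2.
Qed.

(** Otherwise letting [c] tend to 0 gives [E (rank1 xi) = 0], as [p] absorbs this operator;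
    faithfulness then forces [xi = 0]. *)
Lemma exists_not_op_le_scale p xi : A p -> projection p -> p xi = xi ->
  xi <> 0 -> exists2 c : R[i], 0 < c & ~ op_le (p * E (rank1 xi)) (c *: p).
Proof.
move=> Ap pp pxi xi0; apply: contrapT => /forall2NP noc; apply: xi0.
apply/rank1_eq0/Efaithful; first exact: rank1_positive.
apply: quadratic_form_eq0 => u; apply/eqP; rewrite eq_le.
apply/andP; split; last exact/(ce_positive EA)/rank1_positive.
apply/ler_addgt0Pr => eps eps0; rewrite add0r.
have pE : p * E (rank1 xi) = E (rank1 xi).
  have -> : E (rank1 xi) = p * E (rank1 xi) * p.
    by rewrite -(ce_bimodule EA)// rank1_conj ?pxi//; case: pp.
  by rewrite !mulrA (proj2 pp).
(* The added 1 allows division even when [p u = 0]. *)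
have d0 : 0 < `|p u| ^+ 2 + 1 by rewrite ltr_wpDl// exprn_ge0.
have [|/contrapT] := noc (eps / (`|p u| ^+ 2 + 1)); first by rewrite divr_gt0.
move=> /(_ u); rewrite pE bop_subE hdotBl subr_ge0 bop_scaleE hdotZl.
rewrite (projection_norm _ pp) => /le_trans; apply.
by rewrite mulrAC ler_pdivrMr// ler_wpM2l ?lerDl// ltW.
Qed.

Lemma atomic_of_faithful_expectation : atomic A.
Proof.
move=> p Ap pp p0.
have [xi pxi xi0] : exists2 xi, p xi = xi & xi <> 0.
  apply: contrapT => /forall2NP nxi; apply: p0; apply: bop_ext => u.
  have [|/contrapT//] := nxi (p u).
  by rewrite -bop_mulE (proj2 pp).
have [c c0 pbad] := exists_not_op_le_scale Ap pp pxi xi0.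
set a := E (rank1 xi) in pbad.
pose good e := op_le (e * a) (c *: e).
have goodD e f : good e -> good f -> good (e + f).
  move=> ge gf u.
  have -> : c *: (e + f) - (e + f) * a = (c *: e - e * a) + (c *: f - f * a).
    by rewrite scalerDr mulrDl opprD addrACA.
  by rewrite bop_addE hdotDl addr_ge0.
pose bad e := [/\ A e, projection e, proj_le e p & ~ good e].
pose T := {e | bad e}.
(* The order is reversed, so that a maximal element for Zorn's lemma is a minimal bad projection. *)
pose rel_T (s t : T) : bool := `[< proj_le (sval t) (sval s) >].
have bad_p : bad p by split=> //; split; exact: (proj2 pp).
have [||||[e [Ae pe ep ebad]] emin] := @Zorn T rel_T.
- by move=> [e [? [? ?] ? ?]]; apply/asboolP; split.
- move=> r s t /asboolP rs /asboolP st.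
  by apply/asboolP; exact: proj_le_trans rs.
- move=> [s bs] [t bt] /asboolP[/= ts st] /asboolP[/= st' ts'].
  have st2 : s = t by rewrite -ts'.
  by subst t; congr exist; exact: Prop_irrelevance.
- move=> B Btot; pose C := [set sval t | t in B].
  have [[t0 Bt0]|B0] := pselect (B !=set0); last first.
    (* The empty chain is bounded by [p] itself. *)
    exists (exist _ p bad_p) => s Bs; exfalso; apply: B0.
    by exists s.
  have [|||q [pq qC Cq Aq]] := @projection_chain_inf _ _ C.
  + by exists (sval t0); exists t0.
  + by move=> _ [[e [? ? ? ?]] _ <-].
  + move=> _ _ [s Bs <-] [t Bt <-].
    by have [/asboolP|/asboolP] := Btot _ _ Bs Bt; [right|left].
  have {}Aq : A q by apply: Aq (vna_closed Avn) _ => _ [[e [? ? ? ?]] _ <-].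
  have badq : bad q.
    split=> //.
      have [Ae pe ep _] := svalP t0; apply: proj_le_trans ep; apply: qC.
      by exists t0.
    move=> goodq.
    (* This choice makes [|(e - q) xi|^2 <= c], so [e - q] is good; if [q] were good too, so would
       be their sum [e]. *)
    have [|e Ce small] := Cq xi (sqrtC c); first by rewrite sqrtC_gt0.
    have [t Bt te] := Ce.
    have [Ae pe ep ebad] := svalP t; rewrite te in Ae pe ep ebad.
    have [qe eq] := qC _ Ce.
    apply: ebad; rewrite -(subrK q e); apply: goodD => //.
    apply: expectation_rank1_le; [exact: vnaB|exact: projectionB|].
    rewrite -[leRHS]sqrtCK.
    by rewrite ler_pXn2r ?nnegrE ?normr_ge0 ?sqrtC_ge0 ?(ltW c0)//; exact: ltW.
  exists (exist _ q badq) => s Bs; apply/asboolP; apply: qC.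
  by exists s.
have rmin s : A s -> projection s -> proj_le s e -> ~ good s -> s = e.
  move=> As ps se bs.
  have bads : bad s by split=> //; exact: proj_le_trans (ep).
  have := emin (exist _ s bads); rewrite /rel_T /= => /(_ (asboolT se)).
  by move/(congr1 sval).
clear emin; exists e; last exact: proj_le_op_le.
split=> //.
  (* The zero projection is good, hence [e] is nonzero. *)
  move=> e0; apply: ebad; rewrite e0 /good mul0r scaler0 /op_le subrr.
  by move=> u; rewrite linear0l.
move=> r Ar pr re; have {re}[re er] := op_le_proj_le pe pr re.
have [gr|br] := pselect (good r); last by right; exact: rmin.
(* With [r] good and [e] bad, the complement [e - r] is bad; minimality gives [e - r = e], that is,
   [r = 0]. *)
left; have br : ~ good (e - r).
  by move=> ger; apply: ebad; rewrite -(subrK r e); exact: goodD.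
have /eqP : e - r = e.
  apply: rmin => //; [exact: vnaB|exact: projectionB|].
  by case: pe => _ e2; split; rewrite ?mulrBl ?mulrBr e2 ?re ?er.
by rewrite -subr_eq0 addrAC subrr sub0r oppr_eq0 => /eqP.
Qed.

End FaithfulExpectation.

Theorem theorem3p2 (R : realType) (H : hilbertType R) (A : set 'B(H)) :
  von_neumann_algebra A -> commutative_algebra A ->
  (exists2 E : {linear 'B(H) -> 'B(H)},
     conditional_expectation A E & faithful E) ->
  atomic A.
Proof.
move=> Avn Acomm [E EA Efaithful].
exact: (atomic_of_faithful_expectation Avn Acomm EA Efaithful).
Qed.
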